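(* Let $M$ be a bicomplex Hilbert space with orthonormal Schauder $\mathbb{T}$-basis $\{m_l\}_{l\ge 1}$, and let $V$ be the set of all $\psi\in M$ of the form $\psi=\sum_{l=1}^\infty w_l m_l$ with all $w_l\in\mathbb{C}(\mathbf{i_1})$. Then, for $k=1,2$, $(V,(\cdot,\cdot)_{\widehat k})$ is a complex (over $\mathbb{C}(\mathbf{i_1})$) Hilbert space.
   Context: Bicomplex numbers: $\mathbb{T}=\{z_1+z_2\mathbf{i_2} : z_1,z_2\in\mathbb{C}(\mathbf{i_1})\}$ with $\mathbb{C}(\mathbf{i_1})=\{x+y\mathbf{i_1}: x,y\in\mathbb{R}\}$, $\mathbf{i_1}^2=\mathbf{i_2}^2=-1$, $\mathbf{j}=\mathbf{i_1}\mathbf{i_2}=\mathbf{i_2}\mathbf{i_1}$, $\mathbf{j}^2=1$; this is a commutative ring. Put $\mathbf{e_1}=(1+\mathbf{j})/2$, $\mathbf{e_2}=(1-\mathbf{j})/2$, so $\mathbf{e_1}+\mathbf{e_2}=1$, $\mathbf{e_1}\mathbf{e_2}=0$, $\mathbf{e_k}^2=\mathbf{e_k}$. Each $w\in\mathbb{T}$ is uniquely $w=z_{\widehat 1}\mathbf{e_1}+z_{\widehat 2}\mathbf{e_2}$ with $z_{\widehat k}\in\mathbb{C}(\mathbf{i_1})$; put $P_k(w)=z_{\widehat k}$ and $w^{\dagger_3}=\bar z_{\widehat 1}\mathbf{e_1}+\bar z_{\widehat 2}\mathbf{e_2}$ (bar = complex conjugation in $\mathbb{C}(\mathbf{i_1})$).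 Let $\mathbb{D}^+=\{x_{\widehat 1}\mathbf{e_1}+x_{\widehat 2}\mathbf{e_2}: x_{\widehat 1},x_{\widehat 2}\in\mathbb{R},\ x_{\widehat 1},x_{\widehat 2}\ge 0\}$. A bicomplex scalar product on a $\mathbb{T}$-module $M$ is a map $(\cdot,\cdot):M\times M\to\mathbb{T}$ such that for all $\psi,\phi,\chi\in M$, $\alpha\in\mathbb{T}$: (1) $(\psi,\phi+\chi)=(\psi,\phi)+(\psi,\chi)$; (2) $(\psi,\alpha\phi)=\alpha(\psi,\phi)$; (3) $(\psi,\phi)=(\phi,\psi)^{\dagger_3}$; (4) $(\psi,\psi)=0\Leftrightarrow\psi=0$. Standing assumption: it is hyperbolic positive, i.e. $(\psi,\psi)\in\mathbb{D}^+$ for all $\psi\in M$. Then $\{M,(\cdot,\cdot)\}$ is called a $\mathbb{T}$-inner product space. Write $(\cdot,\cdot)_{\widehat k}=P_k((\cdot,\cdot))$. The induced $\mathbb{T}$-norm is $\|\phi\|=\frac{1}{\sqrt2}\sqrt{(\mathbf{e_1}\phi,\mathbf{e_1}\phi)_{\widehat 1}+(\mathbf{e_2}\phi,\mathbf{e_2}\phi)_{\widehat 2}}$. A bicomplex Hilbert space is a $\mathbb{T}$-inner product space that is complete with respect to $\|\cdot\|$. A Schauder $\mathbb{T}$-basis of $M$ is a countable set $\{m_1,\dots,m_l,\dots\}$ of elements of $M$ such that every $\psi\in M$ admits a unique decomposition as a ($\|\cdot\|$-)convergent series $\psi=\sum_{l=1}^\infty w_l m_l$ with $w_l\in\mathbb{T}$.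 It is orthonormal if $(m_l,m_l)=1$ for all $l$ and $(m_l,m_p)=0$ for $l\ne p$. Complex scalar products are linear in the second argument. *)

(* Defs.v *)
From HB Require Import structures.
From mathcomp Require Import all_boot all_order all_algebra.
From mathcomp Require Import complex.
From mathcomp Require Import ring.
From mathcomp Require Import all_classical all_reals all_analysis.

Set Implicit Arguments.
Unset Strict Implicit.
Unset Printing Implicit Defensive.

Import Order.TTheory GRing.Theory Num.Theory.
Import numFieldNormedType.Exports.

Local Open Scope classical_set_scope.
Local Open Scope ring_scope.

(* [Bicomplex z1 z2] is z1 + z2 i2, where z1, z2 are in C(i1) := R[i]. *)
Record bicomplex (R : realType) := Bicomplex { bc1 : R[i]; bc2 : R[i] }.

Section BicomplexRing.
Variable R : realType.
Local Notation T := (bicomplex R).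
Local Notation C := R[i].
Implicit Types u v w : T.

Definition bc_pair w : C * C := (bc1 w, bc2 w).
Definition pair_bc (p : C * C) : T := Bicomplex p.1 p.2.
Lemma bc_pairK : cancel bc_pair pair_bc. Proof. by case. Qed.
HB.instance Definition _ := Choice.copy T (can_type bc_pairK).

Lemma bicomplexP u v : bc1 u = bc1 v -> bc2 u = bc2 v -> u = v.
Proof. by case: u v => [? ?] [? ?] /= -> ->. Qed.

Definition bc_add u v : T := Bicomplex (bc1 u + bc1 v) (bc2 u + bc2 v).
Definition bc_opp u : T := Bicomplex (- bc1 u) (- bc2 u).
Definition bc_mul u v : T :=
  Bicomplex (bc1 u * bc1 v - bc2 u * bc2 v) (bc1 u * bc2 v + bc2 u * bc1 v).

Lemma bc_addA : associative bc_add.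
Proof. by move=> u v w; apply: bicomplexP; rewrite /= addrA. Qed.
Lemma bc_addC : commutative bc_add.
Proof. by move=> u v; apply: bicomplexP; rewrite /= addrC. Qed.
Lemma bc_add0 : left_id (Bicomplex 0 0) bc_add.
Proof. by move=> u; apply: bicomplexP; rewrite /= add0r. Qed.
Lemma bc_addN : left_inverse (Bicomplex 0 0) bc_opp bc_add.
Proof. by move=> u; apply: bicomplexP; rewrite /= addNr. Qed.
HB.instance Definition _ :=
  GRing.isZmodule.Build T bc_addA bc_addC bc_add0 bc_addN.

Lemma bc_mulA : associative bc_mul.
Proof. by move=> u v w; apply: bicomplexP => /=; ring. Qed.
Lemma bc_mulC : commutative bc_mul.
Proof. by move=> u v; apply: bicomplexP => /=; ring. Qed.
Lemma bc_mul1 : left_id (Bicomplex 1 0) bc_mul.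
Proof. by move=> u; apply: bicomplexP => /=; ring. Qed.
Lemma bc_mulDl : left_distributive bc_mul +%R.
Proof. by move=> u v w; apply: bicomplexP => /=; ring. Qed.
Lemma bc_1neq0 : Bicomplex 1 0 != 0 :> T.
Proof. by apply/eqP => -[/eqP]; rewrite oner_eq0. Qed.
HB.instance Definition _ :=
  GRing.Zmodule_isComNzRing.Build T bc_mulA bc_mulC bc_mul1 bc_mulDl bc_1neq0.

Definition bcC (z : C) : T := Bicomplex z 0.
Definition i1 : T := bcC (0 +i* 1)%C.
Definition i2 : T := Bicomplex 0 1.
Definition j : T := i1 * i2.
Definition e1 : T := bcC 2^-1 * (1 + j).
Definition e2 : T := bcC 2^-1 * (1 - j).

(* The idempotent components; [idempotentE] and [idempotent_uniq] show that
   they are the unique coefficients of w on e1 and e2. *)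
Definition P1 w : C := bc1 w - (0 +i* 1)%C * bc2 w.
Definition P2 w : C := bc1 w + (0 +i* 1)%C * bc2 w.

Definition dagger3 w : T := bcC (P1 w)^*%C * e1 + bcC (P2 w)^*%C * e2.

Definition hyperbolic_nonneg : set T :=
  [set w | exists x1 x2 : R, [/\ 0 <= x1, 0 <= x2 &
     w = bcC x1%:C%C * e1 + bcC x2%:C%C * e2]].

Lemma bcC1 : bcC 1 = 1. Proof. by []. Qed.
Lemma bcCD x y : bcC (x + y) = bcC x + bcC y.
Proof. by apply: bicomplexP => //=; rewrite addr0. Qed.
Lemma bcCM x y : bcC (x * y) = bcC x * bcC y.
Proof. by apply: bicomplexP => /=; ring. Qed.

Lemma i_sqr : (0 +i* 1)%C * (0 +i* 1)%C = -1 :> C.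
Proof. by rewrite -expr2 sqr_i. Qed.

Lemma bc_combE (x y : C) :
  bcC x * e1 + bcC y * e2 =
  Bicomplex ((x + y) / 2) ((0 +i* 1)%C * (x - y) / 2).
Proof.
rewrite /e1 /e2 /j /i1 /i2; move: (Complex 0 1) => i.
by apply: bicomplexP => /=; ring.
Qed.

Lemma idempotentE w : w = bcC (P1 w) * e1 + bcC (P2 w) * e2.
Proof.
have h2 : (2 : C) != 0 by rewrite pnatr_eq0.
rewrite bc_combE /P1 /P2; have := i_sqr; move: (Complex 0 1) => i ii.
apply: bicomplexP => /=; first by field.
have -> : i * (bc1 w - i * bc2 w - (bc1 w + i * bc2 w)) / 2
  = - (i * i) * bc2 w by field.
by rewrite ii; ring.
Qed.

Lemma idempotent_uniq (x y : C) w :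
  w = bcC x * e1 + bcC y * e2 -> x = P1 w /\ y = P2 w.
Proof.
have h2 : (2 : C) != 0 by rewrite pnatr_eq0.
move=> ->; rewrite bc_combE /P1 /P2 /=.
have := i_sqr; move: (Complex 0 1) => i ii.
have -> : i * (i * (x - y) / 2) = (i * i) * (x - y) / 2 by ring.
by rewrite ii; split; field.
Qed.

End BicomplexRing.

Arguments i1 {R}.
Arguments i2 {R}.
Arguments j {R}.
Arguments e1 {R}.
Arguments e2 {R}.

(* Restriction of scalars from the bicomplex numbers to C(i1). *)
Definition complex_restr (R : realType) (M : lmodType (bicomplex R)) : Type :=
  M.

Section ComplexRestr.
Variables (R : realType) (M : lmodType (bicomplex R)).
HB.instance Definition _ := GRing.Zmodule.copy (complex_restr M) M.

Definition complex_restr_scale (z : R[i]) (x : complex_restr M) :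
  complex_restr M := bcC z *: (x : M).

Lemma complex_restr_scaleA a b v : complex_restr_scale a
  (complex_restr_scale b v) = complex_restr_scale (a * b) v.
Proof. by rewrite /complex_restr_scale bcCM scalerA. Qed.
Lemma complex_restr_scale1 : left_id 1 complex_restr_scale.
Proof. by move=> v; rewrite /complex_restr_scale bcC1 scale1r. Qed.
Lemma complex_restr_scaleDr : right_distributive complex_restr_scale +%R.
Proof. by move=> a u v; rewrite /complex_restr_scale scalerDr. Qed.
Lemma complex_restr_scaleDl v :
  {morph complex_restr_scale^~ v : a b / a + b}.
Proof. by move=> a b; rewrite /complex_restr_scale bcCD scalerDl. Qed.
HB.instance Definition _ :=
  GRing.Zmodule_isLmodule.Build R[i] (complex_restr M) complex_restr_scaleA
    complex_restr_scale1 complex_restr_scaleDr complex_restr_scaleDl.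
End ComplexRestr.

Section NormConvergence.
Variables (R : realType) (E : zmodType) (norm : E -> R).

Definition norm_cvg (u : nat -> E) (l : E) : Prop :=
  norm (u n - l) @[n --> \oo] --> (0 : R).

Definition norm_cauchy (u : nat -> E) : Prop :=
  forall e : R, 0 < e -> \forall p & q \near \oo, norm (u p - u q) < e.

Definition norm_complete (S : set E) : Prop :=
  forall u : nat -> E, (forall n, S (u n)) -> norm_cauchy u ->
    exists2 l, S l & norm_cvg u l.
End NormConvergence.

Section ComplexHilbert.
Variables (R : realType) (E : lmodType R[i]).

Record linear_subspace (S : set E) : Prop := {
  subspace0 : S 0;
  subspaceD : forall x y, S x -> S y -> S (x + y);
  subspaceZ : forall (a : R[i]) x, S x -> S (a *: x) }.

(* [0 <= z] in R[i] means that z is real and nonnegative. *)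
Record complex_scalar_product (S : set E) (ip : E -> E -> R[i]) : Prop := {
  csp_addr : forall x y z, S x -> S y -> S z ->
    ip x (y + z) = ip x y + ip x z;
  csp_scaler : forall (a : R[i]) x y, S x -> S y ->
    ip x (a *: y) = a * ip x y;
  csp_conj : forall x y, S x -> S y -> ip x y = (ip y x)^*%C;
  csp_ge0 : forall x, S x -> 0 <= ip x x;
  csp_eq0 : forall x, S x -> (ip x x = 0 <-> x = 0) }.

Definition complex_norm (ip : E -> E -> R[i]) (x : E) : R :=
  Num.sqrt (complex.Re (ip x x)).

(* (S, ip) is a complex Hilbert space, the operations of S being those of E;
   only the values of ip on S matter. *)
Record complex_hilbert (S : set E) (ip : E -> E -> R[i]) : Prop := {
  ch_subspace : linear_subspace S;
  ch_scalar_product : complex_scalar_product S ip;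
  ch_complete : norm_complete (complex_norm ip) S }.
End ComplexHilbert.

Section BicomplexHilbert.
Variables (R : realType) (M : lmodType (bicomplex R)).
Variable ip : M -> M -> bicomplex R.

Record bicomplex_scalar_product : Prop := {
  bsp_addr : forall x y z, ip x (y + z) = ip x y + ip x z;
  bsp_scaler : forall (a : bicomplex R) x y, ip x (a *: y) = a * ip x y;
  bsp_dagger : forall x y, ip x y = dagger3 (ip y x);
  bsp_eq0 : forall x, ip x x = 0 <-> x = 0 }.

Definition hyperbolic_positive : Prop :=
  forall x, hyperbolic_nonneg (ip x x).

Definition ip1 (x y : M) : R[i] := P1 (ip x y).
Definition ip2 (x y : M) : R[i] := P2 (ip x y).

(* For a hyperbolic positive scalar product, both values under the square root
   are real, so that taking real parts loses nothing. *)
Definition bicomplex_norm (x : M) : R :=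
  (Num.sqrt 2)^-1 *
  Num.sqrt (complex.Re (ip1 (e1 *: x) (e1 *: x) + ip2 (e2 *: x) (e2 *: x))).

Record bicomplex_hilbert : Prop := {
  bh_scalar_product : bicomplex_scalar_product;
  bh_positive : hyperbolic_positive;
  bh_complete : norm_complete bicomplex_norm setT }.

Definition series_to (w : nat -> bicomplex R) (m : nat -> M) (x : M) : Prop :=
  norm_cvg bicomplex_norm (series (fun l => w l *: m l)) x.

Definition schauder_basis (m : nat -> M) : Prop :=
  forall x, exists! w : nat -> bicomplex R, series_to w m x.

Definition orthonormal_family (m : nat -> M) : Prop :=
  (forall l, ip (m l) (m l) = 1) /\ (forall l p, l != p -> ip (m l) (m p) = 0).

Definition complex_span (m : nat -> M) : set (complex_restr M) :=
  [set x | exists z : nat -> R[i], series_to (fun l => bcC (z l)) m x].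
End BicomplexHilbert.

(* Main.v *)
(* The coefficients of x on an orthonormal basis are w_l = (m_l, x), so V is the
   set of x such that P1 (m_l, x) = P2 (m_l, x) for all l. Bessel's inequality
   for a single m_l makes these conditions continuous, whence V is closed.
   By Pythagoras, the partial sums s_n of x in V satisfy
     (s_n - x, s_n - x) = (x, x) - sum_(l < n) |w_l|^2
   in both components, so that P1 (x, x) - P2 (x, x) tends to 0 along with
   s_n - x: on V both component norms coincide with the T-norm, for which V is
   complete, being closed in M. *)
From HB Require Import structures.
Require Import Defs.
From mathcomp Require Import all_boot all_order all_algebra.
From mathcomp Require Import complex.
From mathcomp Require Import ring.
From mathcomp Require Import all_classical all_reals all_analysis.

Set Implicit Arguments.
Unset Strict Implicit.
Unset Printing Implicit Defensive.

Import Order.TTheory GRing.Theory Num.Theory.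
Import numFieldNormedType.Exports.

Local Open Scope classical_set_scope.
Local Open Scope ring_scope.

(** * Idempotent components of bicomplex numbers *)

Section Components.
Variable R : realType.
Implicit Types (u v w : bicomplex R) (z : R[i]).

Lemma P1_zmod_morphism : zmod_morphism (@P1 R).
Proof.
by move=> u v; rewrite /P1 /=; move: (Complex 0 1) => i; ring.
Qed.

Lemma P2_zmod_morphism : zmod_morphism (@P2 R).
Proof.
by move=> u v; rewrite /P2 /=; move: (Complex 0 1) => i; ring.
Qed.

(** [P1] substitutes -i1 for i2, and [P2] substitutes i1; both are multiplicative because i1 and -i1
    square to -1, as i2 does. *)
Lemma P1_monoid_morphism : monoid_morphism (@P1 R).
Proof.
split=> [|u v]; first by rewrite /P1 /= mulr0 subr0.
rewrite /P1 /=; have := i_sqr R; move: (Complex 0 1) => i ii.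
have -> : - (bc2 u * bc2 v) = (i * i) * (bc2 u * bc2 v) by rewrite ii mulN1r.
ring.
Qed.

Lemma P2_monoid_morphism : monoid_morphism (@P2 R).
Proof.
split=> [|u v]; first by rewrite /P2 /= mulr0 addr0.
rewrite /P2 /=; have := i_sqr R; move: (Complex 0 1) => i ii.
have -> : - (bc2 u * bc2 v) = (i * i) * (bc2 u * bc2 v) by rewrite ii mulN1r.
ring.
Qed.

HB.instance Definition _ :=
  GRing.isZmodMorphism.Build (bicomplex R) R[i] (@P1 R) P1_zmod_morphism.
HB.instance Definition _ :=
  GRing.isMonoidMorphism.Build (bicomplex R) R[i] (@P1 R) P1_monoid_morphism.
HB.instance Definition _ :=
  GRing.isZmodMorphism.Build (bicomplex R) R[i] (@P2 R) P2_zmod_morphism.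
HB.instance Definition _ :=
  GRing.isMonoidMorphism.Build (bicomplex R) R[i] (@P2 R) P2_monoid_morphism.

Lemma bicomplex_eq u v : P1 u = P1 v -> P2 u = P2 v -> u = v.
Proof. by move=> e e'; rewrite (idempotentE u) e e' -idempotentE. Qed.

Lemma P1_bcC z : P1 (bcC z) = z. Proof. by rewrite /P1 /= mulr0 subr0. Qed.
Lemma P2_bcC z : P2 (bcC z) = z. Proof. by rewrite /P2 /= mulr0 addr0. Qed.

Lemma P1_e1 : P1 (e1 : bicomplex R) = 1.
Proof.
have [] := @idempotent_uniq R 1 0 e1; last by [].
by apply: bicomplexP => /=; ring.
Qed.

Lemma P2_e2 : P2 (e2 : bicomplex R) = 1.
Proof.
have [] := @idempotent_uniq R 0 1 e2; last by [].
by apply: bicomplexP => /=; ring.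
Qed.

(* What the proof uses of P1 and P2, so that both are treated at once. *)
Definition conj_component (P : bicomplex R -> R[i]) : Prop :=
  [/\ forall w, P (dagger3 w) = (P w)^*%C,
      forall z, P (bcC z) = z
    & forall w, hyperbolic_nonneg w -> 0 <= P w <= P1 w + P2 w].

Lemma hyperbolic_nonnegP w :
  hyperbolic_nonneg w -> 0 <= P1 w /\ 0 <= P2 w.
Proof.
by move=> [x1 [x2 [x1ge0 x2ge0 /idempotent_uniq[<- <-]]]]; rewrite !ler0c.
Qed.

Lemma P1_component : conj_component (@P1 R).
Proof.
split=> [w | z | w /hyperbolic_nonnegP[w1 w2]].
- by have [<-] := idempotent_uniq (erefl (dagger3 w)).
- exact: P1_bcC.
- by rewrite w1 lerDl.
Qed.

Lemma P2_component : conj_component (@P2 R).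
Proof.
split=> [w | z | w /hyperbolic_nonnegP[w1 w2]].
- by have [_ <-] := idempotent_uniq (erefl (dagger3 w)).
- exact: P2_bcC.
- by rewrite w2 lerDr.
Qed.

(** The passage to the limit used throughout: below, [z] is a defect independent of n and [e] is the
    norm of an error, or its square. *)
Lemma cvg0_norm_le_eq0 z (c : R) (e : nat -> R) :
  e n @[n --> \oo] --> (0 : R) ->
  (\forall n \near \oo, `|z| <= (c * e n)%:C%C) -> z = 0.
Proof.
move=> e0 ze; apply/normr0_eq0/le_anti; rewrite normr_ge0 andbT.
(* The modulus lives in [R[i]]; naming its real value [r] brings the inequality back to limits in
   [R]. *)
have [r zr] : exists r : R, `|z| = r%:C%C by rewrite normc_def; eexists.
rewrite zr -[0]/(0%:C%C) lecR.
have ce0 : c * e n @[n --> \oo] --> (0 : R).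
  by rewrite -(mulr0 c); apply: cvgM e0; exact: cvg_cst.
rewrite -(cvg_lim (@Rhausdorff R) ce0); apply: limr_ge; first exact: cvgP ce0.
by near=> n; rewrite -lecR -zr; near: n.
Unshelve. all: by end_near.
Qed.

End Components.

(** * Bessel's inequality and the T-norm *)

Section ScalarProduct.
Variables (R : realType) (M : lmodType (bicomplex R)).
Variable ip : M -> M -> bicomplex R.
Hypothesis bsp : bicomplex_scalar_product ip.
Hypothesis pos : hyperbolic_positive ip.
Implicit Types (x y e : M) (P : {rmorphism bicomplex R -> R[i]}).
Local Notation N := (bicomplex_norm ip).

Lemma ip0r x : ip x 0 = 0.
Proof. by rewrite -(scale0r 0) (bsp_scaler bsp) mul0r. Qed.

Lemma ipBr x y y' : ip x (y - y') = ip x y - ip x y'.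
Proof. by rewrite (bsp_addr bsp) -scaleN1r (bsp_scaler bsp) mulN1r. Qed.

Lemma ip_sumr x (w : nat -> bicomplex R) (f : nat -> M) n :
  ip x (\sum_(0 <= k < n) w k *: f k) = \sum_(0 <= k < n) w k * ip x (f k).
Proof.
rewrite (big_morph (ip x) (bsp_addr bsp x) (ip0r x)).
by apply: eq_bigr => k _; exact: bsp_scaler.
Qed.

Lemma dagger3_0 : dagger3 (0 : bicomplex R) = 0.
Proof.
have [d1 _ _] := P1_component R; have [d2 _ _] := P2_component R.
by apply: bicomplex_eq; rewrite ?d1 ?d2 !rmorph0.
Qed.

Lemma ip_eq0C x y : ip x y = 0 -> ip y x = 0.
Proof. by move=> xy0; rewrite (bsp_dagger bsp) xy0 dagger3_0. Qed.

(** Under [P], [dagger3] becomes complex conjugation, which is additive, so linearity on the right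
    carries over to the left. *)
Lemma ipBl P x x' y : conj_component P ->
  P (ip (x - x') y) = P (ip x y) - P (ip x' y).
Proof.
case=> Pd _ _.
by rewrite (bsp_dagger bsp) Pd ipBr !rmorphB /= -!Pd -!(bsp_dagger bsp).
Qed.

(** Positivity is applied to y = x - (e, x) e, the part of x orthogonal to e. *)
Lemma component_bessel P e x : conj_component P -> ip e e = 1 ->
  `|P (ip e x)| ^+ 2 <= P (ip x x).
Proof.
move=> Pc ee; case: (Pc) => Pd _ Pge0; set a := ip e x; set y := x - a *: e.
have yx0 : ip y e = 0.
  by apply: ip_eq0C; rewrite ipBr (bsp_scaler bsp) ee mulr1 subrr.
have Pxx : (P (ip x x))^*%C = P (ip x x) by rewrite -Pd -(bsp_dagger bsp).
have /andP[+ _] := Pge0 _ (pos y).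
(* As y is orthogonal to e, (y, y) = (y, x), which is then expanded through its conjugate (x, y). *)
rewrite {2}/y ipBr (bsp_scaler bsp) yx0 mulr0 subr0 (bsp_dagger bsp) Pd.
rewrite ipBr (bsp_scaler bsp) (bsp_dagger bsp x e) rmorphB rmorphM Pd -/a.
by rewrite rmorphB rmorphM /= Pxx conjcK mulrC -sqr_normc subr_ge0.
Qed.

Lemma bicomplex_norm_ge0 x : 0 <= N x.
Proof. by rewrite mulr_ge0 ?invr_ge0 ?sqrtr_ge0. Qed.

(** Since [P1 e1 = 1] and [P2 e2 = 1], the idempotent factors in the norm change nothing; the 2
    cancels its factor 1/sqrt 2. *)
Lemma bicomplex_norm_sqr x : (2 * N x ^+ 2)%:C%C = ip1 ip x x + ip2 ip x x.
Proof.
have [d1 _ _] := P1_component R; have [d2 _ _] := P2_component R.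
have E1 : ip1 ip (e1 *: x) (e1 *: x) = ip1 ip x x.
  rewrite /ip1 (bsp_scaler bsp) rmorphM /= P1_e1 mul1r (bsp_dagger bsp) d1.
  by rewrite (bsp_scaler bsp) rmorphM /= P1_e1 mul1r -d1 -(bsp_dagger bsp).
have E2 : ip2 ip (e2 *: x) (e2 *: x) = ip2 ip x x.
  rewrite /ip2 (bsp_scaler bsp) rmorphM /= P2_e2 mul1r (bsp_dagger bsp) d2.
  by rewrite (bsp_scaler bsp) rmorphM /= P2_e2 mul1r -d2 -(bsp_dagger bsp).
have [h1 h2] := hyperbolic_nonnegP (pos x).
have : 0 <= ip1 ip x x + ip2 ip x x by rewrite addr_ge0.
rewrite /bicomplex_norm E1 E2; move: (_ + _) => -[a b].
(* Nonnegativity in [R[i]] makes the imaginary part vanish. *)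
rewrite lecE /= => /andP[/eqP-> a0].
by rewrite exprMn exprVn !sqr_sqrtr // mulrA divff ?mul1r // pnatr_eq0.
Qed.

(** By Bessel, |P (e, x)|^2 is at most P (x, x), hence at most P1 (x, x) + P2 (x, x) = 2 N(x)^2. *)
Lemma component_norm_le P e x : conj_component P -> ip e e = 1 ->
  `|P (ip e x)| <= (Num.sqrt 2 * N x)%:C%C.
Proof.
move=> Pc ee; case: (Pc) => _ _ Pge0.
rewrite -(@ler_pXn2r _ 2) ?nnegrE ?normr_ge0 //; last first.
  by rewrite ler0c mulr_ge0 ?sqrtr_ge0 ?bicomplex_norm_ge0.
apply: le_trans (component_bessel x Pc ee) _.
rewrite -rmorphXn /= exprMn sqr_sqrtr // bicomplex_norm_sqr.
by have /andP[] := Pge0 _ (pos x).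
Qed.

End ScalarProduct.

(** * Basis expansions and the space V *)

Section OrthonormalBasis.
Variables (R : realType) (M : lmodType (bicomplex R)).
Variables (ip : M -> M -> bicomplex R) (m : nat -> M).
Hypothesis hilbert : bicomplex_hilbert ip.
Hypothesis basis : schauder_basis ip m.
Hypothesis orthonormal : orthonormal_family ip m.
Implicit Types (x : M) (P : {rmorphism bicomplex R -> R[i]}).
Local Notation N := (bicomplex_norm ip).
Let bsp := bh_scalar_product hilbert.
Let pos := bh_positive hilbert.

Lemma ip_partial_sum (w : nat -> bicomplex R) l n : (l < n)%N ->
  ip (m l) (series (fun k => w k *: m k) n) = w l.
Proof.
move=> ln; rewrite /series /= (ip_sumr bsp).
rewrite (bigD1_seq l) ?iota_uniq ?mem_index_iota //= orthonormal.1 mulr1.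
by rewrite big1 ?addr0 // => k kl; rewrite orthonormal.2 ?mulr0 // eq_sym.
Qed.

(** For n > l, w_l - (m_l, x) = (m_l, s_n - x), where s_n is the n-th partial sum; its components
    are at most sqrt 2 N(s_n - x). *)
Lemma series_to_coef w x l : series_to ip w m x -> w l = ip (m l) x.
Proof.
move=> wx.
suff Pwx P : conj_component P -> P (w l) = P (ip (m l) x).
  by apply: bicomplex_eq; apply: Pwx; [exact: P1_component|exact: P2_component].
move=> Pc; apply/eqP; rewrite -subr_eq0; apply/eqP.
apply: (cvg0_norm_le_eq0 (c := Num.sqrt 2) wx).
near=> n; rewrite -rmorphB -[in X in `|X|](@ip_partial_sum w l n); last first.
  by near: n; exact: nbhs_infty_gt.
by rewrite -(ipBr bsp); exact: (component_norm_le bsp pos _ Pc (orthonormal.1 l)).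
Unshelve. all: by end_near.
Qed.

Lemma series_to_ip x : series_to ip (fun l => ip (m l) x) m x.
Proof.
have [w [wx _]] := basis x.
suff <- : w = fun l => ip (m l) x by [].
by apply/funext => l; exact: series_to_coef.
Qed.

(** A bicomplex number lies in C(i1) exactly when its two idempotent components agree. *)
Lemma complex_spanP x :
  complex_span ip m x <-> forall l, P1 (ip (m l) x) = P2 (ip (m l) x).
Proof.
split=> [[z zx] l|x12].
  by rewrite -(series_to_coef l zx) P1_bcC P2_bcC.
exists (fun l => P1 (ip (m l) x)).
suff -> : (fun l => bcC (P1 (ip (m l) x))) = fun l => ip (m l) x.
  exact: series_to_ip.
by apply/funext => l; apply: bicomplex_eq; rewrite ?P1_bcC ?P2_bcC.
Qed.

(** s - x is orthogonal to each m_l with l < n, hence to s, which leaves P (s - x, s - x) = - P (x,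
    s - x). *)
Lemma component_pythagoras P x n : conj_component P ->
  let s := series (fun l => ip (m l) x *: m l) n in
  P (ip (s - x) (s - x)) =
    P (ip x x) - \sum_(0 <= l < n) P (ip (m l) x) * (P (ip (m l) x))^*%C.
Proof.
move=> Pc s; case: (Pc) => Pd _ _.
have rs : ip s (s - x) = 0.
  apply: (ip_eq0C bsp); rewrite {2}/s /series /= (ip_sumr bsp).
  rewrite big_nat big1 // => l /= ln; rewrite (@ip_eq0C _ _ _ bsp (m l)) ?mulr0 //.
  by rewrite (ipBr bsp) ip_partial_sum ?subrr.
rewrite (ipBl bsp _ _ _ Pc) rs rmorph0 sub0r (ipBr bsp) rmorphB opprB.
congr (_ - _); rewrite /s /series /= (ip_sumr bsp) rmorph_sum.
by apply: eq_bigr => l _; rewrite rmorphM (bsp_dagger bsp x) Pd.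
Qed.

Lemma complex_span_ip12 x : complex_span ip m x -> ip1 ip x x = ip2 ip x x.
Proof.
move=> /complex_spanP x12; apply/eqP; rewrite -subr_eq0; apply/eqP.
have := series_to_ip x; rewrite /series_to /norm_cvg; set e := fun n => N _ => e0.
have ee0 : e n ^+ 2 @[n --> \oo] --> (0 : R).
  by rewrite -(mulr0 0); under eq_fun do rewrite expr2; exact: cvgM.
(* The constant is that of |P1 (r, r) - P2 (r, r)| <= P1 (r, r) + P2 (r, r) = 2 N(r)^2. *)
apply: (cvg0_norm_le_eq0 (c := 2) ee0); apply: nearW => n.
rewrite (bicomplex_norm_sqr bsp pos).
set r := series _ n - x.
have -> : ip1 ip x x - ip2 ip x x = ip1 ip r r - ip2 ip r r.
  rewrite /ip1 /ip2 (component_pythagoras _ _ (P1_component R)).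
  rewrite (component_pythagoras _ _ (P2_component R)).
  (* For x in V the sums subtracted in the two components are equal and cancel. *)
  under eq_bigr do rewrite /= x12.
  by rewrite opprB addrA subrK.
have [h1 h2] := hyperbolic_nonnegP (pos r).
by apply: le_trans (ler_normB _ _) _; rewrite !ger0_norm.
Qed.

Lemma complex_span_closed (u : nat -> M) x :
  (forall n, complex_span ip m (u n)) -> norm_cvg N u x -> complex_span ip m x.
Proof.
move=> uV ux; apply/complex_spanP => l; apply/eqP; rewrite -subr_eq0; apply/eqP.
(* Each of the two components of (m_l, u_n - x) contributes sqrt 2 N(u_n - x). *)
apply: (cvg0_norm_le_eq0 (c := 2 * Num.sqrt 2) ux); apply: nearW => n.
have /complex_spanP/(_ l) un12 := uV n.
have -> : P1 (ip (m l) x) - P2 (ip (m l) x) =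
    P2 (ip (m l) (u n - x)) - P1 (ip (m l) (u n - x)).
  by rewrite (ipBr bsp) !rmorphB /= un12; ring.
apply: le_trans (ler_normB _ _) _.
rewrite -mulrA mulr_natl mulr2n rmorphD /= lerD //.
  exact: (component_norm_le bsp pos _ (P2_component R) (orthonormal.1 l)).
exact: (component_norm_le bsp pos _ (P1_component R) (orthonormal.1 l)).
Qed.

Lemma complex_span_subspace :
  linear_subspace (E := complex_restr M) (complex_span ip m).
Proof.
split=> [|x y /complex_spanP xV /complex_spanP yV|a x /complex_spanP xV].
- by apply/complex_spanP => l; rewrite (ip0r bsp) !rmorph0.
- by apply/complex_spanP => l; rewrite (bsp_addr bsp) !rmorphD /= xV yV.
- apply/complex_spanP => l; rewrite (bsp_scaler bsp) !rmorphM /= xV.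
  by rewrite P1_bcC P2_bcC.
Qed.

Lemma complex_span_norm x : complex_span ip m x ->
  ip1 ip x x = (N x ^+ 2)%:C%C /\ ip2 ip x x = (N x ^+ 2)%:C%C.
Proof.
move=> xV; have x12 := complex_span_ip12 xV.
suff h : ip2 ip x x = (N x ^+ 2)%:C%C by rewrite x12.
apply: (@mulfI _ (2 : R[i])); first by rewrite pnatr_eq0.
rewrite [LHS]mulr_natl mulr2n -{1}x12 -(bicomplex_norm_sqr bsp pos).
by rewrite rmorphM /= rmorph_nat.
Qed.

(** The second hypothesis identifies the norm of the component with N on V, so that Cauchy sequences
    and limits are the same for both. *)
Lemma complex_span_hilbert P : conj_component P ->
  (forall x, complex_span ip m x -> P (ip x x) = (N x ^+ 2)%:C%C) ->
  complex_hilbert (E := complex_restr M) (complex_span ip m)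
    (fun x y => P (ip x y)).
Proof.
move=> Pc PN; case: (Pc) => Pd PC Pge0.
have VB x y : complex_span ip m x -> complex_span ip m y ->
    complex_span ip m (x - y).
  move=> /complex_spanP xV /complex_spanP yV; apply/complex_spanP => l.
  by rewrite (ipBr bsp) !rmorphB /= xV yV.
have normE x : complex_span ip m x ->
    complex_norm (E := complex_restr M) (fun x y => P (ip x y)) x = N x.
  move=> xV; rewrite /complex_norm PN //= sqrtr_sqr ger0_norm //.
  exact: bicomplex_norm_ge0.
split; first exact: complex_span_subspace.
  split=> [x y z _ _ _|a x y _ _|x y _ _|x _|x xV].
  - by rewrite (bsp_addr bsp) rmorphD.
  - by rewrite (bsp_scaler bsp) rmorphM PC.
  - by rewrite (bsp_dagger bsp) Pd.
  - by have /andP[] := Pge0 _ (pos x).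
  - split=> [|->]; last by rewrite (ip0r bsp) rmorph0.
    (* One vanishing component gives N(x)^2 = 0, so both components of (x, x) vanish. *)
    have [x1 x2] := complex_span_norm xV.
    rewrite PN // => N0; apply/(bsp_eq0 bsp).
    by apply: bicomplex_eq; rewrite rmorph0 /= -N0.
move=> u uV ucauchy.
have [x _ ux] : exists2 x, setT x & norm_cvg N u x.
  apply: (bh_complete hilbert) => // e /ucauchy.
  by apply: filterS => -[p q] /=; rewrite normE //; exact: VB.
have xV := complex_span_closed uV ux.
exists x => //; rewrite /norm_cvg.
rewrite (_ : (fun n => _) = fun n => N (u n - x)) //.
by apply/funext => n; rewrite normE //; exact: VB.
Qed.

End OrthonormalBasis.

Theorem theorem3p12 (R : realType) (M : lmodType (bicomplex R))
  (ip : M -> M -> bicomplex R) (m : nat -> M) :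
  bicomplex_hilbert ip ->
  schauder_basis ip m ->
  orthonormal_family ip m ->
  complex_hilbert (E := complex_restr M) (complex_span ip m) (ip1 ip) /\
  complex_hilbert (E := complex_restr M) (complex_span ip m) (ip2 ip).
Proof.
move=> hilbert basis orthonormal.
have span_norm := complex_span_norm hilbert basis orthonormal.
split.
- apply: (complex_span_hilbert hilbert basis orthonormal (P1_component R)).
  by move=> x /span_norm[].
- apply: (complex_span_hilbert hilbert basis orthonormal (P2_component R)).
  by move=> x /span_norm[].
Qed.
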